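(* For each integer $d\ge 2$ let $c_d$ denote the $d$-dimensional rectilinear crossing number of the complete $d$-uniform hypergraph $K^d_{2d}$ with $2d$ vertices, i.e. the minimum number of crossing pairs of hyperedges over all $d$-dimensional rectilinear drawings of $K^d_{2d}$ (vertices in general position in $\mathbb{R}^d$). Then $c_d=\Omega(2^d)$ as $d\to\infty$; that is, there exist a constant $C>0$ and an integer $d_0$ such that $c_d\ge C\,2^d$ for all $d\ge d_0$.
   Context: The complete $d$-uniform hypergraph $K^d_n$ has $n$ vertices, and its hyperedges are all $d$-element subsets of the vertex set. Points in $\mathbb{R}^d$ are in general position if no $d+1$ of them lie on a common hyperplane. A $d$-dimensional rectilinear drawing of a $d$-uniform hypergraph with $n\ge 2d$ vertices places the vertices at points in general position in $\mathbb{R}^d$ and draws each hyperedge as the $(d-1)$-simplex that is the convex hull of its $d$ vertices. Two hyperedges form a crossing pair if they are vertex-disjoint and the corresponding simplices have a common point in their relative interiors. Pairs of hyperedges are unordered. *)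

(* Defs.v *)
From mathcomp Require Import all_boot all_order all_algebra.
From mathcomp Require Import all_classical all_reals all_analysis.

Set Implicit Arguments.
Unset Strict Implicit.
Unset Printing Implicit Defensive.

Import Order.TTheory GRing.Theory Num.Theory.
Import numFieldNormedType.Exports.

Local Open Scope classical_set_scope.
Local Open Scope ring_scope.

Section Geometry.
Variables (R : realType) (d : nat).
Implicit Types A H : set 'rV[R]_d.

Definition convex_hull A : set 'rV[R]_d :=
  [set x | exists (m : nat) (v : 'I_m -> 'rV[R]_d) (w : 'I_m -> R),
    [/\ forall i, A (v i), forall i, 0 <= w i,
        \sum_i w i = 1 & x = \sum_i w i *: v i]].

Definition affine_hull A : set 'rV[R]_d :=
  [set x | exists (m : nat) (v : 'I_m -> 'rV[R]_d) (w : 'I_m -> R),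
    [/\ forall i, A (v i), \sum_i w i = 1 & x = \sum_i w i *: v i]].

(* The library puts the sup norm on row vectors; its topology is the
   Euclidean one. *)
Definition relative_interior A : set 'rV[R]_d :=
  [set x | A x /\ \forall y \near x, affine_hull A y -> A y].

Definition is_hyperplane H : Prop :=
  exists (a : 'rV[R]_d) (b : R),
    a != 0 /\ H = [set x | \sum_j a 0 j * x 0 j = b].

End Geometry.

Section Drawing.
Variables (R : realType) (d n : nat).
Implicit Types (p : 'I_n -> 'rV[R]_d) (E F : {set 'I_n}).

(* The condition ranges over sets of vertices rather than of points, so for
   0 < d < n it also forces p to be injective: two vertices at the same point,
   together with any d - 1 others, would lie on a common hyperplane. *)
Definition general_position p : Prop :=
  forall S : {set 'I_n}, #|S| = d.+1 ->
    ~ exists2 H, is_hyperplane H & forall i, i \in S -> H (p i).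

Definition hyperedges : {set {set 'I_n}} := [set E : {set 'I_n} | #|E| == d]%SET.

Definition simplex p E : set 'rV[R]_d := convex_hull (p @` [set` E]).

Definition crosses p E F : Prop :=
  [disjoint E & F]%B /\
  relative_interior (simplex p E) `&` relative_interior (simplex p F) !=set0.

(* An unordered pair is the set of its two members. *)
Definition crossing_pairs p : {set {set {set 'I_n}}} :=
  [set P : {set {set 'I_n}} |
    `[< exists E F, [/\ E \in hyperedges, F \in hyperedges,
          P = [set E; F]%SET & crosses p E F] >] ]%SET.

Definition drawing_with_crossings (k : nat) : bool :=
  `[< exists p, general_position p /\ #|crossing_pairs p| = k >].

Definition moment_curve (i : 'I_n) : 'rV[R]_d := \row_j (i%:R ^+ j.+1).

Lemma moment_curve_general_position : general_position moment_curve.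
Proof.
move=> S cS [H [a [b [a0 HE]]] HS]; rewrite {}HE in HS.
pose q : {poly R} := \poly_(k < d.+1)
  (if k is k'.+1 then oapp (a 0) 0 (insub k' : option 'I_d) else - b).
have qE (i : 'I_n) : i \in S -> root q i%:R.
  move=> iS; have /= := HS _ iS => e.
  rewrite /root horner_poly big_ord_recl /= expr0 mulr1 -e addrC subr_eq0.
  by apply/eqP/eq_bigr => j _; rewrite mxE /= valK /=.
have q0 : q = 0.
  apply: (@roots_geq_poly_eq0 _ q [seq (i : 'I_n)%:R | i <- enum S]).
  - by apply/allP => r /mapP[i]; rewrite mem_enum => iS ->; exact: qE.
  - rewrite map_inj_uniq ?enum_uniq// => i j /eqP; rewrite eqr_nat => /eqP.
    exact: val_inj.
  - by rewrite size_map -cardE cS size_poly.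
case/negP: a0; apply/eqP/rowP => j; rewrite mxE.
have := congr1 (fun r : {poly R} => r`_j.+1) q0.
by rewrite coef_poly coef0 ltnS ltn_ord valK.
Qed.

Lemma drawing_exists : exists k, drawing_with_crossings k.
Proof.
exists #|crossing_pairs moment_curve|; apply/asboolP.
by exists moment_curve; split=> //; exact: moment_curve_general_position.
Qed.

Definition rectilinear_crossing_number : nat := ex_minn drawing_exists.

End Drawing.

(* Main.v *)
Require Import Defs.
From mathcomp Require Import all_boot all_order all_algebra.
From mathcomp Require Import all_classical all_reals all_analysis.
From mathcomp Require Import fintype finset zify ring lra.

(** Let [p] place the [2 d] vertices in general position.  If an affine
    dependency of the points is positive on a [d]-set [E] and negative off
    [E], then, after scaling, it exhibits one point as a convex combination
    with positive weights of either side, so [E] and its complement cross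
    ([crossing_of_affine_dependency]).  The task is to find many sign vectors
    of dependencies with exactly [d] plus signs.  The dependencies form a
    space of dimension [d - 1], and general position makes this space uniform:
    a dependency is determined by its values on any [d - 1] vertices, and
    those values are arbitrary.

    One well balanced dependency yields about [2 ^ d / sqrt d] crossing pairs.
    Suppose that a dependency vanishes exactly on a set [Z] of [d - 2]
    vertices, and let [P] be the set of the vertices where it is positive.
    Adding a small dependency with prescribed signs on [Z] realizes every
    choice of signs on [Z] and keeps the other signs ([cocircuit_signs]).
    Hence every [d]-set [E] whose part off [Z] is [P] crosses its complement.
    There are ['C(d - 2, d - #|P|)] such sets, and this is a central binomial
    coefficient when [P] has half of the [d + 2] vertices off [Z], rounded in
    either direction.

    Balanced dependencies exist in abundance: every set [Z0] of [d - 3]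
    vertices extends by one vertex to such a [Z] ([balanced_cocircuit]).  The
    dependencies vanishing on [Z0] form a plane.  When a line turns in that
    plane, the difference between the numbers of plus and minus signs changes
    its own sign over a half turn, by steps of two, so it passes near zero.

    It remains to collect about [sqrt d] such families without much overlap,
    which makes up for the factor lost to the binomial coefficient.  With
    [N] the integer square root of [d], take a set of [d - 3 + N] vertices
    and, for each [i < N], remove from it the [i]-th of [N] disjoint blocks of
    [N] vertices.  A set [E] in the families of both [i] and [j] is determined
    by its trace on the intersection of the two zero sets, which has at most
    [d - 1 - N] elements ([card_subcube_layerI]).  So two families share at
    most [2 ^ (d - 1 - N)] sets, a negligible number, and by Bonferroni's
    inequality the union of the families has at least a constant times
    [2 ^ d] elements ([card_crossing_pairs_lower]). *)

Set Implicit Arguments.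
Unset Strict Implicit.
Unset Printing Implicit Defensive.

Import Order.TTheory GRing.Theory Num.Theory.
Import numFieldNormedType.Exports.

(** * Counting in finite sets and binomial estimates *)

(** Read [a] as the sign of the entries of [s], and flip the signs of the
    entries behind a cut that moves from the left end of [s] to the right.
    The number of plus signs goes from [count (predC a) s] to [count a s],
    whose mean is half of [size s], and each entry passed changes it by one:
    some entry is passed while the number crosses that mean. *)
Lemma balanced_split (T : Type) (a : pred T) (s : seq T) : (0 < size s)%N ->
  exists l x r, s = l ++ x :: r /\
    let c := (count a l + count (predC a) r)%N in
    (c.*2 <= size s <= c.*2.+2)%N.
Proof.
move=> s0.
(* The cut moves from the end of [s1] to the right. *)
have H (s1 s2 : seq T) (b : pred T) :
    (count b s1 + count (predC b) s2).*2 <= size (s1 ++ s2) ->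
    size (s1 ++ s2) <= (count b (s1 ++ s2)).*2 -> 0 < size s2 ->
  exists l x r, s1 ++ s2 = l ++ x :: r /\
    let c := count b l + count (predC b) r in
    c.*2 <= size (s1 ++ s2) <= c.*2.+2.
  elim: s2 s1 => [//|x s2 IH] s1 /= h1 h2 _.
  set c := count b s1 + b x + count (predC b) s2.
  have [h|h] := leqP (size (s1 ++ x :: s2)) c.*2.
    exists s1, x, s2; split=> //.
    by move: h1 h; rewrite /c size_cat /=; case: (b x) => /=; lia.
  have := IH (rcons s1 x); rewrite cat_rcons => /(_ _ h2) IH'.
  apply: IH'; first by move: h; rewrite /c -cats1 count_cat /=; lia.
  rewrite lt0n; apply/eqP => /size0nil s20; subst s2.
  by move: h2 h; rewrite /c count_cat /=; lia.
have sz : count a s + count (predC a) s = size s by exact: count_predC.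
have [h|h] := leqP (size s) ((count a s).*2).
  by apply: (H [::] s a) => //=; lia.
(* Otherwise the minus signs are in the majority. *)
have [||//|l [x [r [e /andP[h1 h2]]]]] := H [::] s (predC a).
- rewrite /= (@eq_count _ _ a) => [|y /=]; first lia.
  by rewrite negbK.
- by rewrite /=; lia.
exists l, x, r; move: h1 h2; rewrite /= in e *.
rewrite (@eq_count _ (predC (predC a)) a); last by move=> y /=; rewrite negbK.
rewrite e size_cat /= => h1 h2; split=> //.
by have := count_predC a l; have := count_predC a r; lia.
Qed.

(** The bound ['C(2 m, m) >= 4 ^ m / (2 sqrt m)], squared to stay in the
    natural numbers. *)
Lemma central_bin_lower m : 16 ^ m.+1 <= 'C(m.+1.*2, m.+1) ^ 2 * (4 * m.+1).
Proof.
elim: m => [|m IH]; first by [].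
have e : m.+2 * 'C(m.+2.*2, m.+2) = (2 * (m.+1.*2.+1)) * 'C(m.+1.*2, m.+1).
  have h1 := mul_bin_diag m.+2.*2 m.+1.
  have h2 := mul_bin_down m.+1.*2.+1 m.+1.
  rewrite [_.+1.-1]/= in h2; rewrite doubleS [_.-1]/= in h1 *.
  rewrite (_ : m.+1.*2.+1 - m.+1 = m.+2) in h2; last lia.
  by nia.
have m0 : 0 < m.+2 * m.+2 by [].
rewrite -(leq_pmul2l m0).
set c := 'C(m.+1.*2, m.+1) in e IH *; set c' := 'C(_, _) in e *.
have -> : m.+2 * m.+2 * (c' ^ 2 * (4 * m.+2)) = (m.+2 * c') ^ 2 * (4 * m.+2).
  by rewrite -!mulnn; ring.
have -> : m.+2 * m.+2 * 16 ^ m.+2 = 16 * m.+2 ^ 2 * 16 ^ m.+1.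
  by rewrite [16 ^ m.+2]expnS -mulnn; ring.
rewrite e; apply: leq_trans (leq_mul (leqnn _) IH) _.
rewrite (_ : _ * _ = 16 * (m.+2 * m.+1) * (c ^ 2 * (4 * m.+2))); last first.
  by rewrite -!mulnn; ring.
have -> : (2 * m.+1.*2.+1 * c) ^ 2 * (4 * m.+2) =
    4 * m.+1.*2.+1 ^ 2 * (c ^ 2 * (4 * m.+2)).
  by rewrite -!mulnn; ring.
by rewrite leq_mul2r -!mulnn; apply/orP; right; lia.
Qed.

(** The slack of one in the two conditions on [k] is what the balancing
    argument leaves open when it splits an odd number of vertices. *)
Lemma near_central_bin_lower n k : n <= k.*2.+1 -> k.*2 <= n.+1 ->
  4 ^ n <= 'C(n, k) ^ 2 * (2 * n.+1).
Proof.
move=> h1 h2.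
have e4 m : 4 ^ m.*2 = 16 ^ m by rewrite -muln2 mulnC expnM.
have odd_case m : 4 ^ m.*2.+1 <= 'C(m.*2.+1, m.+1) ^ 2 * (2 * m.*2.+2).
  have := central_bin_lower m; rewrite doubleS binS -(@bin_sub _ m); last lia.
  rewrite (_ : m.*2.+1 - m = m.+1); last lia.
  rewrite [4 ^ _]expnS e4 [16 ^ _]expnS -!mulnn.
  by move: (16 ^ m) ('C(_, _)) => x c; lia.
have [b|b] := boolP (odd n).
  have en : n = n./2.*2.+1 by rewrite -[LHS]odd_double_half b.
  have : k = n./2.+1 \/ k = n./2 by lia.
  move: n./2 en => m -> [->|->]; first exact: odd_case.
  rewrite -bin_sub; last lia.
  rewrite (_ : m.*2.+1 - m = m.+1); last lia.
  exact: odd_case.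
have en : n = k.*2 by move: (odd_double_half n); rewrite (negPf b); lia.
move: en => {h1 h2 b} ->; case: k => [//|k].
rewrite e4; apply: leq_trans (central_bin_lower k) _.
by rewrite leq_mul2l; apply/orP; right; lia.
Qed.

Lemma card_bigcup_le (T : finType) (F : nat -> {set T}) (N q : nat) :
  (forall i, i < N -> #|F i| <= q) -> #|\bigcup_(i < N) F i| <= N * q.
Proof.
elim: N => [|N IH] h; first by rewrite big_ord0 cards0.
rewrite big_ord_recr /= mulSnr (leq_trans (leq_card_setU _ _))//.
by rewrite leq_add ?h// IH// => i iN; rewrite h// ltnW.
Qed.

(** Each new set meets the union of the earlier ones in at most [N * q]
    elements. *)
Lemma bonferroni (T : finType) (F : nat -> {set T}) (N q : nat) :
  (forall i j, i < j < N -> #|F i :&: F j| <= q) ->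
  \sum_(i < N) #|F i| <= #|\bigcup_(i < N) F i| + N * (N * q).
Proof.
elim: N => [|N IH] hq; first by rewrite big_ord0.
rewrite !big_ord_recr /=; set U := \bigcup_(i < N) _.
have h1 : \sum_(i < N) #|F i| <= #|U| + N * (N * q).
  by apply: IH => i j /andP[ij h]; rewrite hq// ij ltnW.
have h3 := cardsUI U (F N).
have h4 : #|U :&: F N| <= N * q.
  rewrite /U big_distrl /=.
  apply: (@card_bigcup_le _ (fun i => F i :&: F N)) => i iN.
  by rewrite hq// iN /=.
move: h1 h3 h4; move: #|U :|: F N| #|U :&: F N| => a c.
move: (\sum_(i < N) _) #|U| #|F N| => s u f; lia.
Qed.

Lemma exists_nat_sqrt d : exists N, N ^ 2 <= d < N.+1 ^ 2.
Proof.
elim: d => [|d [N /andP[h1 h2]]]; first by exists 0.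
have [h|h] := ltnP d.+1 (N.+1 ^ 2); first by exists N; rewrite h leqW.
by exists N.+1; rewrite h /=; move: h2; rewrite -!mulnn; lia.
Qed.

Lemma exp2_ge_12sqr N : 11 <= N -> 12 * N ^ 2 <= 2 ^ N.
Proof.
elim: N => [//|N IH]; rewrite leq_eqVlt => /orP[/eqP <-//|h].
rewrite [2 ^ N.+1]expnS; apply: leq_trans (leq_mul (leqnn 2) (IH h)).
by rewrite -!mulnn; nia.
Qed.

Lemma card_ord_interval n a b : b <= n ->
  #|[set v : 'I_n | a <= v < b]| = b - a.
Proof.
move=> bn; rewrite cardsE -sum1_card -[RHS]muln1 -sum_nat_const_nat.
rewrite (big_nat_widen _ _ _ _ _ bn) (big_nat_widenl _ 0)//.
by rewrite big_mkord; apply: eq_bigl => i; rewrite unfold_in /= andbC.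
Qed.

Section Subcubes.
Variable T : finType.
Implicit Types (Z P E : {set T}) (m : nat).

(** Sets agreeing with [P] off [Z] form a subcube of the cube of all sets;
    the layer is its slice at cardinality [m]. *)
Definition subcube_layer Z P m := [set E | (E :\: Z == P) && (#|E| == m)].

Lemma card_subcube_layer Z P m : [disjoint P & Z] -> #|P| <= m ->
  'C(#|Z|, m - #|P|) <= #|subcube_layer Z P m|.
Proof.
move=> dPZ Pm; rewrite -cards_draws.
set D := [set B : {set T} | _].
have PZ : P :\: Z = P by apply/setDidPl.
rewrite -(@card_in_imset _ _ (fun B => P :|: B) D); last first.
  move=> B B'; rewrite !inE => /andP[BZ _] /andP[BZ' _] /(congr1 (setI Z)).
  rewrite !setIUr; have -> : Z :&: P = set0.
    by apply/eqP; rewrite setI_eq0 disjoint_sym.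
  by rewrite !set0U; move/setIidPr: BZ => ->; move/setIidPr: BZ' => ->.
apply/subset_leq_card/subsetP => E /imsetP[B]; rewrite inE => /andP[BZ cB] ->.
rewrite inE setDUl PZ.
have -> : B :\: Z = set0 by apply/eqP; rewrite setD_eq0.
rewrite setU0 eqxx /= cardsU (eqP cB).
have -> : P :&: B = set0.
  by apply/eqP; rewrite setI_eq0; apply: disjointWr BZ _; exact: dPZ.
by rewrite cards0 subn0 subnKC.
Qed.

(** A common element is known off [Z] and off [Z'], hence is determined by
    its trace on the intersection. *)
Lemma card_subcube_layerI Z P Z' P' m :
  #|subcube_layer Z P m :&: subcube_layer Z' P' m| <= 2 ^ #|Z :&: Z'|.
Proof.
rewrite -card_powerset.
set D := _ :&: _.
rewrite -(@card_in_imset _ _ (fun E => E :&: (Z :&: Z')) D); last first.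
  move=> E E'; rewrite !inE => /andP[/andP[/eqP e1 _] /andP[/eqP e2 _]].
  move=> /andP[/andP[/eqP e1' _] /andP[/eqP e2' _]] /setP eI; apply/setP => v.
  have := eI v; rewrite !inE.
  have [vZ|vZ] /= := boolP (v \in Z); last first.
    by move=> _; have /setP/(_ v) := etrans e1 (esym e1'); rewrite !inE vZ.
  have [vZ'|vZ'] /= := boolP (v \in Z'); first by rewrite !andbT.
  by move=> _; have /setP/(_ v) := etrans e2 (esym e2'); rewrite !inE vZ'.
apply/subset_leq_card/subsetP => _ /imsetP[E _ ->].
by rewrite powersetE subsetIr.
Qed.

End Subcubes.

(** * Affine dependencies of points in general position *)

Local Open Scope ring_scope.

Lemma sgr_addl_small (R : realDomainType) (a b : R) : `|b| < `|a| ->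
  Num.sg (a + b) = Num.sg a.
Proof.
case: (ltrgt0P a) => [a0|a0|->]; last by rewrite normr_lt0.
  by rewrite ltr_norml => /andP[h _]; rewrite !gtr0_sg//; lra.
by rewrite ltr_norml => /andP[_ h]; rewrite !ltr0_sg//; lra.
Qed.

Section Dependencies.
Context {R : realType} {d n : nat} (p : 'I_n -> 'rV[R]_d).
Implicit Types (lam mu : 'rV[R]_n) (S : {set 'I_n}).

(** The leading coordinate 1 turns affine relations between the points into
    linear relations between the rows. *)
Definition homogenized : 'M[R]_(n, 1 + d) :=
  \matrix_i row_mx (const_mx 1) (p i).

Definition affine_dependency lam := lam *m homogenized = 0.

Lemma affine_dependencyP lam : affine_dependency lam <->
  \sum_i lam 0 i = 0 /\ \sum_i lam 0 i *: p i = 0.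
Proof.
rewrite /affine_dependency mulmx_sum_row.
under eq_bigr do rewrite rowK scale_row_mx.
split=> [h|[h1 h2]].
  have e1 := congr1 lsubmx h; have e2 := congr1 rsubmx h.
  rewrite !linear0 !linear_sum /= in e1 e2; split.
    have := congr1 (fun A : 'M[R]_1 => A 0 0) e1.
    rewrite summxE !mxE => e; rewrite -[RHS]e; apply: eq_bigr => i _.
    by rewrite row_mxKl !mxE mulr1.
  by rewrite -[RHS]e2; apply: eq_bigr => i _; rewrite row_mxKr.
rewrite -[LHS]hsubmxK !linear_sum /= -[RHS]hsubmxK !linear0.
congr row_mx.
  apply/matrixP => i j; rewrite summxE !mxE !ord1 -[RHS]h1.
  by apply: eq_bigr => k _; rewrite row_mxKl !mxE mulr1.
by rewrite -[RHS]h2; apply: eq_bigr => i _; rewrite row_mxKr.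
Qed.

Lemma affine_dependencyD lam mu : affine_dependency lam ->
  affine_dependency mu -> affine_dependency (lam + mu).
Proof. by rewrite /affine_dependency mulmxDl => -> ->; rewrite addr0. Qed.

Lemma affine_dependencyZ c lam : affine_dependency lam ->
  affine_dependency (c *: lam).
Proof. by rewrite /affine_dependency -scalemxAl => ->; rewrite scaler0. Qed.

(** [nu] is [lam] plus a multiple of [mu] too small to change a nonzero
    sign. *)
Lemma sign_perturb lam mu : affine_dependency lam ->
  affine_dependency mu -> exists2 nu, affine_dependency nu &
  forall i, Num.sg (nu 0 i) =
    if lam 0 i == 0 then Num.sg (mu 0 i) else Num.sg (lam 0 i).
Proof.
move=> dl dm.
pose e := \big[Order.min/1]_(i | lam 0 i != 0) (`|lam 0 i| / (1 + `|mu 0 i|)).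
have m0 i : 0 < 1 + `|mu 0 i| by rewrite ltr_pwDl.
have e0 : 0 < e.
  by apply/lt_bigmin => // i li; rewrite divr_gt0// normr_gt0.
exists (lam + e *: mu); first exact/affine_dependencyD/affine_dependencyZ.
move=> i; rewrite !mxE; case: eqP => [->|/eqP li].
  by rewrite add0r sgrM gtr0_sg// mul1r.
apply: sgr_addl_small; rewrite normrM gtr0_norm//.
have : e <= `|lam 0 i| / (1 + `|mu 0 i|) by exact: bigmin_le_cond.
rewrite ler_pdivlMr//; apply: lt_le_trans.
by rewrite ltr_pM2l// ltrDr.
Qed.

Hypothesis gp : general_position p.

(** A vector orthogonal to the chosen rows is the equation of a hyperplane
    through the points of [S]; its linear part is nonzero because the
    homogenizing coordinate of every row is 1. *)
Lemma general_position_row_full S : #|S| = d.+1 ->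
  row_full (rowsub (@enum_val _ (mem S)) homogenized).
Proof.
move=> cS; set A := rowsub _ _; rewrite -cokermx_eq0; apply/negPn/negP => nz.
have [k [l ckl]] := matrix0Pn _ nz.
pose c := col l (cokermx A).
have Ac i : i \in S -> c (lshift d 0) 0 + \sum_j p i 0 j * c (rshift 1 j) 0 = 0.
  move=> iS; have : row i homogenized *m c = 0.
    have <- : row (enum_rank_in iS i) A = row i homogenized.
      by rewrite row_rowsub enum_rankK_in.
    by rewrite /c -row_mul colE mulmxA mulmx_coker mul0mx linear0.
  move=> /matrixP/(_ 0 0); rewrite rowK mxE big_split_ord /= big_ord1 [RHS]mxE.
  rewrite row_mxEl mxE mul1r => e; rewrite -[RHS]e; congr +%R.
  by apply: eq_bigr => j _; rewrite row_mxEr.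
have [i0 i0S] : exists i, i \in S by apply/set0Pn; rewrite -card_gt0 cS.
pose a : 'rV_d := \row_j c (rshift 1 j) 0.
apply: (gp cS).
exists [set x : 'rV_d | \sum_j a 0 j * x 0 j = - c (lshift d 0) 0]%classic;
    last first.
  move=> i iS /=; apply/eqP; rewrite -addr_eq0 addrC -[X in _ == X](Ac i iS).
  by apply/eqP; congr +%R; apply: eq_bigr => j _; rewrite mxE mulrC.
exists a, (- c (lshift d 0) 0); split=> //.
apply/negP => /eqP/rowP a0.
have a0' j : c (rshift 1 j) 0 = 0 by have := a0 j; rewrite !mxE.
have b0 : c (lshift d 0) 0 = 0.
  by have := Ac _ i0S; rewrite big1 ?addr0// => j _; rewrite a0' mulr0.
have ck : c k 0 = 0.
  case: (splitP k) => j kj.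
    by rewrite (_ : k = lshift d 0) ?b0//; apply: val_inj; rewrite /= kj ord1.
  by rewrite (_ : k = rshift 1 j) ?a0'//; apply: val_inj.
move: ckl; rewrite (_ : cokermx A k l = c k 0); last by rewrite [RHS]mxE.
by rewrite ck eqxx.
Qed.

(** As many rows as columns: full rank makes the rows in [S] independent. *)
Lemma affine_dependency_eq0 S lam : #|S| = d.+1 -> affine_dependency lam ->
  {in ~: S, forall i, lam 0 i = 0} -> lam = 0.
Proof.
move=> cS dl l0; have := general_position_row_full cS.
set A := rowsub _ _ => full.
have free : row_free A by rewrite /row_free (eqP full) cS.
pose u : 'rV_#|S| := \row_i lam 0 (enum_val i).
have u0 : u = 0.
  apply: (row_free_inj free).
  rewrite mul0mx -[RHS]dl !mulmx_sum_row (bigID (mem S)) /=.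
  rewrite [X in _ = _ + X]big1 => [|i iS]; last first.
    by rewrite l0 ?scale0r// inE.
  rewrite addr0 [RHS]big_enum_val /=; apply: eq_bigr => i _.
  by rewrite mxE row_rowsub.
apply/rowP => i; rewrite mxE; have [iS|iS] := boolP (i \in S); last first.
  by rewrite l0// inE.
have /rowP/(_ (enum_rank_in iS i)) := u0.
by rewrite !mxE enum_rankK_in.
Qed.

(** The rows in [S] span the whole space, so they compensate any combination
    of the other rows. *)
Lemma affine_dependency_exists S (f : 'I_n -> R) : #|S| = d.+1 ->
  exists2 lam, affine_dependency lam & {in ~: S, forall i, lam 0 i = f i}.
Proof.
move=> cS; have := general_position_row_full cS.
set A := rowsub _ _ => full.
have /submxP[u ue] :=
  submx_full (- \sum_(i in ~: S) f i *: row i homogenized) full.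
have [i0 i0S] : exists i, i \in S by apply/set0Pn; rewrite -card_gt0 cS.
exists (\row_i if i \in S then u 0 (enum_rank_in i0S i) else f i); last first.
  by move=> i; rewrite inE mxE => /negPf ->.
rewrite /affine_dependency mulmx_sum_row (bigID (mem S)) /=.
rewrite -[X in _ + X]opprK -[X in _ = X](subrr (u *m A)); congr (_ - _).
  rewrite mulmx_sum_row [LHS]big_enum_val /=; apply: eq_bigr => i _.
  by rewrite mxE enum_valP enum_valK_in row_rowsub.
rewrite -ue; congr (- _); apply: eq_big => [i|i /negPf iS].
  by rewrite inE.
by rewrite mxE iS.
Qed.

Lemma affine_dependency_two_zeros (Y : {set 'I_n}) lam i j :
  #|Y| = d.+3 -> affine_dependency lam -> {in ~: Y, forall k, lam 0 k = 0} ->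
  i \in Y -> j \in Y -> i != j -> lam 0 i = 0 -> lam 0 j = 0 -> lam = 0.
Proof.
move=> cY dl l0 iY jY ij li lj.
apply: (@affine_dependency_eq0 (Y :\ i :\ j)) => //.
  have := cardsD1 i Y; have := cardsD1 j (Y :\ i).
  by rewrite iY !inE jY eq_sym ij cY /=; lia.
move=> k; rewrite !inE !negb_and !negbK => /or3P[/eqP->|/eqP->|kY] //.
by rewrite l0// inE.
Qed.

(** Up to scaling, the dependencies supported in [Y] that vanish at a further
    vertex are the [be + t k *: mu] below, where [mu] vanishes nowhere on [Y]
    and the slopes [t k] are pairwise distinct.  The sign of [be + t k *: mu]
    at [i] is that of [mu] if [t i < t k], and the opposite one if
    [t k < t i].  With [Y] sorted by slope, a well balanced [k] is therefore
    an entry provided by [balanced_split]. *)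
Lemma balanced_cocircuit (Y : {set 'I_n}) : #|Y| = d.+3 ->
  exists2 z, z \in Y & exists lam, [/\ affine_dependency lam,
    forall i, (lam 0 i != 0) = (i \in Y :\ z) &
    (d.+1 <= #|[set i | (0 < lam 0 i)%R]|.*2 <= d.+3)%N].
Proof.
move=> cY.
have [x xY] : exists x, x \in Y by apply/set0Pn; rewrite -card_gt0 cY.
have cYx : #|Y :\ x| = d.+2 by have := cardsD1 x Y; rewrite xY cY; lia.
have [y] : exists y, y \in Y :\ x by apply/set0Pn; rewrite -card_gt0 cYx.
rewrite !inE => /andP[yx yY].
have cS : #|Y :\ x :\ y| = d.+1.
  by have := cardsD1 y (Y :\ x); rewrite cYx !inE yx yY /=; lia.
have off i : i \in ~: (Y :\ x :\ y) = [|| i == y, i == x | i \notin Y].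
  by rewrite !inE !negb_and !negbK.
have [al dal ale] := affine_dependency_exists (fun i => (i == x)%:R) cS.
have [be dbe bee] := affine_dependency_exists (fun i => (i == y)%:R) cS.
have offY i : i \notin Y -> (al 0 i = 0) * (be 0 i = 0).
  move=> iY; rewrite ale ?bee ?off ?iY ?orbT//.
  have [e|_] := eqVneq i x; first by rewrite e xY in iY.
  by have [e|_] := eqVneq i y; first by rewrite e yY in iY.
have alx : al 0 x = 1 by rewrite ale ?eqxx// off eqxx orbT.
have aly : al 0 y = 0 by rewrite ale ?(negPf yx)// off eqxx.
have bex : be 0 x = 0 by rewrite bee 1?eq_sym ?(negPf yx)// off eqxx orbT.
have bey : be 0 y = 1 by rewrite bee ?eqxx// off eqxx.
have al0 i : i \in Y -> i != y -> al 0 i != 0.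
  move=> iY iy; apply/eqP => ali.
  have al_0 : al = 0.
    apply: (affine_dependency_two_zeros cY dal _ iY yY iy ali aly).
    by move=> k; rewrite inE => kY; rewrite offY.
  by move: alx; rewrite al_0 mxE => /esym/eqP; rewrite oner_eq0.
(* [al] vanishes on [Y] at [y] only, where [be] is nonzero. *)
have [mu dmu mue] := sign_perturb dal dbe.
have mu0 i : (mu 0 i == 0) = (i \notin Y).
  rewrite -sgr_eq0 mue; have [->|iy] := eqVneq i y.
    by rewrite aly eqxx bey sgr1 oner_eq0 yY.
  have [iY|iY] := boolP (i \in Y); last by rewrite !offY// eqxx sgr0 eqxx.
  by rewrite (negPf (al0 _ iY iy)) sgr_eq0 (negPf (al0 _ iY iy)).
pose t i : R := - be 0 i / mu 0 i.
have lamE k i : i \in Y -> (be + t k *: mu) 0 i = mu 0 i * (t k - t i).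
  move=> iY; rewrite !mxE; move: (t k) => tk; rewrite /t.
  have mui : mu 0 i != 0 by rewrite mu0 iY.
  by field.
have dlam k : affine_dependency (be + t k *: mu).
  exact/affine_dependencyD/affine_dependencyZ.
have lam0 k i : i \notin Y -> (be + t k *: mu) 0 i = 0.
  move=> iY; rewrite !mxE offY// add0r.
  by move: (mu0 i); rewrite iY => /eqP ->; rewrite mulr0.
(* Equal slopes would give a dependency with two zeros on [Y]; such a
   dependency is zero, while [be] is not a multiple of [mu]. *)
have tinj i j : i \in Y -> j \in Y -> i != j -> t i != t j.
  move=> iY jY ij; apply/eqP => tij.
  have b0 : be + t i *: mu = 0.
    apply: (affine_dependency_two_zeros cY _ _ iY jY ij) => //.
    - by move=> k; rewrite inE => /lam0.
    - by rewrite lamE// subrr mulr0.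
    - by rewrite lamE// tij subrr mulr0.
  have ti0 : t i = 0.
    have /rowP/(_ x) := b0; rewrite !mxE bex add0r => /eqP.
    by rewrite mulf_eq0 mu0 xY orbF => /eqP.
  move: b0; rewrite ti0 scale0r addr0 => be0.
  by move: bey; rewrite be0 mxE => /esym/eqP; rewrite oner_eq0.
pose s := sort (fun i j => t i <= t j) (enum Y).
have sY i : (i \in s) = (i \in Y) by rewrite mem_sort mem_enum.
have us : uniq s by rewrite sort_uniq enum_uniq.
have ss : size s = d.+3 by rewrite size_sort -cardE.
have pws : pairwise (fun i j => t i <= t j) s.
  rewrite -sorted_pairwise; last by move=> ? ? ?; exact: le_trans.
  by apply: sort_sorted => i j; exact: le_total.
have [|l [k [r [es /andP[h1 h2]]]]] :=
    @balanced_split _ (fun i => 0 < mu 0 i) s.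
  by rewrite ss.
rewrite ss in h1 h2.
have kY : k \in Y by rewrite -sY es mem_cat mem_head orbT.
move: us pws; rewrite es cat_uniq pairwise_cat /= => /and4P[ul hl kr ur].
rewrite allrel_consr => /andP[/andP[lk _] /and3P[_ kr' _]].
have ltk i : i \in l -> t i < t k.
  move=> il; rewrite lt_neqAle (allP lk)// andbT tinj//.
    by rewrite -sY es mem_cat il.
  by apply: contraNneq hl => <-; rewrite /= il.
have gtk i : i \in r -> t k < t i.
  move=> ir; rewrite lt_neqAle (allP kr')// andbT tinj//.
    by rewrite -sY es mem_cat inE ir !orbT.
  by apply: contraNneq kr => ->.
exists k => //; exists (be + t k *: mu); split=> //.
  move=> i; rewrite in_setD1.
  have [iY|iY] := boolP (i \in Y); last by rewrite lam0// eqxx andbF.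
  rewrite lamE// mulf_eq0 mu0 iY /= subr_eq0 andbT.
  by have [->|ik] := eqVneq i k; rewrite ?eqxx// eq_sym tinj.
have -> : #|[set i | (0 < (be + t k *: mu) 0 i)%R]| =
    (count (fun i => (0 < mu 0 i)%R) l +
     count (predC (fun i => (0 < mu 0 i)%R)) r)%N.
  have -> : #|[set i | (0 < (be + t k *: mu) 0 i)%R]| =
      count (fun i => (0 < (be + t k *: mu) 0 i)%R) s.
    rewrite -size_filter -(card_uniqP _) ?filter_uniq ?sort_uniq ?enum_uniq//.
    apply: eq_card => i; rewrite inE mem_filter sY.
    by have [//|iY] := boolP (i \in Y); rewrite ?andbT// lam0// ltxx.
  rewrite es count_cat /= lamE// subrr mulr0 ltxx add0n; congr addn.
    apply: eq_in_count => i il.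
    by rewrite lamE ?pmulr_lgt0 ?subr_gt0 ?ltk// -sY es mem_cat il.
  apply: eq_in_count => i ir /=.
  have iY : i \in Y by rewrite -sY es mem_cat inE ir !orbT.
  rewrite lamE// nmulr_lgt0 ?subr_lt0 ?gtk// -leNgt le_eqVlt mu0 iY //.
by move: (_ + _)%N h1 h2 => c; clear; lia.
Qed.

(** The dependency [lam] has the desired signs on its support [W]; the signs
    on the remaining vertices can be prescribed freely, and a small
    perturbation adds them. *)
Lemma cocircuit_signs (W E : {set 'I_n}) lam : #|W| = d.+2 ->
  affine_dependency lam -> (forall i, (lam 0 i != 0) = (i \in W)) ->
  E :&: W = [set i | 0 < lam 0 i] ->
  exists nu, [/\ affine_dependency nu, {in E, forall i, 0 < nu 0 i} &
    {in ~: E, forall i, nu 0 i < 0}].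
Proof.
move=> cW dl lW EW.
have [x xW] : exists x, x \in W by apply/set0Pn; rewrite -card_gt0 cW.
have cS : #|W :\ x| = d.+1 by have := cardsD1 x W; rewrite xW cW; lia.
have [mu dmu mue] := affine_dependency_exists
   (fun i => if i \in E then 1 else -1) cS.
have [nu dnu nue] := sign_perturb dl dmu.
(* Off [W] the sign is the prescribed one, on [W] that of [lam]. *)
have nuE i : Num.sg (nu 0 i) = if i \in E then 1 else -1.
  rewrite nue; case: (boolP (lam 0 i == 0)) => li.
    rewrite mue ?(fun_if Num.sg) ?sgrN ?sgr1//.
    by rewrite !inE negb_and -lW li orbT.
  have /setP/(_ i) := EW; rewrite !inE -lW li andbT => ->.
  by case: (ltrgt0P (lam 0 i)) li => // h _; [rewrite gtr0_sg|rewrite ltr0_sg].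
exists nu; split=> // i; rewrite ?inE => iE.
  by rewrite -sgr_gt0 nuE iE ltr01.
by rewrite -sgr_lt0 nuE (negPf iE) ltrN10.
Qed.

End Dependencies.

(** * Crossing pairs and affine dependencies *)

Lemma continuous_mulmx_coord (R : realType) (d n : nat) (Q : 'M[R]_(d, n)) i :
  continuous (fun y : 'rV[R]_d => (y *m Q) 0 i).
Proof.
rewrite (_ : (fun y => _) = fun y : 'rV[R]_d => \sum_j y 0 j * Q j i).
  apply: continuous_big => [|j _ y]; first exact: add_continuous.
  by apply: (cvgMl (FF := nbhs_filter y)); exact: coord_continuous.
by apply/funext => y; rewrite mxE.
Qed.

Section Crossing.
Context {R : realType} {d n : nat} (p : 'I_n -> 'rV[R]_d).
Implicit Types (E S : {set 'I_n}) (u : 'I_n -> R).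

Lemma simplex_convex_combination S u : {in S, forall i, 0 <= u i} ->
  \sum_(i in S) u i = 1 -> simplex p S (\sum_(i in S) u i *: p i).
Proof.
move=> u0 u1; exists #|S|, (fun k => p (enum_val k)), (fun k => u (enum_val k)).
split=> [k|k||]; last by rewrite big_enum_val.
- by exists (enum_val k) => //=; exact: enum_valP.
- by rewrite u0// enum_valP.
- by rewrite -u1 [RHS]big_enum_val.
Qed.

(** Rows off [S] are cleared rather than removed, so that weights stay indexed
    by all the vertices. *)
Definition simplex_rows S : 'M[R]_(n, 1 + d) :=
  \matrix_i (if i \in S then row i (homogenized p) else 0).

Lemma mul_simplex_rows S (v : 'rV_n) : v *m simplex_rows S =
  row_mx (const_mx (\sum_(i in S) v 0 i)) (\sum_(i in S) v 0 i *: p i).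
Proof.
rewrite mulmx_sum_row (bigID (mem S)) /=.
rewrite [X in _ + X]big1 => [|i iS]; last by rewrite rowK (negPf iS) scaler0.
rewrite addr0 -[LHS]hsubmxK !linear_sum /=; congr row_mx.
  apply/rowP => j; rewrite summxE mxE; apply: eq_bigr => i iS.
  by rewrite rowK iS rowK scale_row_mx row_mxKl !mxE mulr1.
by apply: eq_bigr => i iS; rewrite rowK iS rowK scale_row_mx row_mxKr.
Qed.

Lemma affine_combination_sub m (M : 'M[R]_(m, 1 + d)) k
    (v : 'I_k -> 'rV[R]_d) (w : 'I_k -> R) : \sum_i w i = 1 ->
  (forall i, (row_mx (const_mx 1) (v i) <= M)%MS) ->
  (row_mx (const_mx 1) (\sum_i w i *: v i) <= M)%MS.
Proof.
move=> w1 vM.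
have -> : row_mx (const_mx 1) (\sum_i w i *: v i) =
    \sum_i w i *: (row_mx (const_mx 1) (v i) : 'rV_(1 + d)).
  rewrite -[RHS]hsubmxK !linear_sum /=; congr row_mx.
    apply/rowP => j; rewrite summxE mxE -[LHS]w1; apply: eq_bigr => i _.
    by rewrite scale_row_mx row_mxKl !mxE mulr1.
  by apply: eq_bigr => i _; rewrite scale_row_mx row_mxKr.
by apply: summx_sub => i _; apply: scalemx_sub.
Qed.

Lemma affine_hull_simplex_sub S (y : 'rV_d) :
  affine_hull (simplex p S) y -> (row_mx (const_mx 1) y <= simplex_rows S)%MS.
Proof.
move=> [m [v [w [vS w1 ->]]]]; apply: affine_combination_sub => // k.
have [m' [v' [w' [vS' _ w1' ->]]]] := vS k.
apply: affine_combination_sub => // i.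
have [j /= jS <-] := vS' i.
have -> : row_mx (const_mx 1) (p j) = row j (simplex_rows S).
  by rewrite rowK jS rowK.
exact: row_sub.
Qed.

(** A point [y] of the affine hull differs from [x] by a combination of the
    vertices whose coefficients [c y] depend linearly on [y - x], through a
    partial inverse of the matrix of the vertices.  For [y] near [x] they are
    too small to make the weights [u i + c y 0 i] negative. *)
Lemma simplex_relative_interior S u : {in S, forall i, 0 < u i} ->
  \sum_(i in S) u i = 1 ->
  relative_interior (simplex p S) (\sum_(i in S) u i *: p i).
Proof.
move=> u0 u1; set x := \sum_(i in S) _.
split; first by apply: simplex_convex_combination => // i /u0/ltW.
pose Q := dsubmx (pinvmx (simplex_rows S)).
pose c (y : 'rV[R]_d) := (y - x) *m Q.
have near_c : \forall y \near x, forall i, i \in S -> 0 < u i + c y 0 i.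
  pose good i := [set y | i \in S -> 0 < u i + c y 0 i]%classic.
  apply: (@filter_forall _ _ good _ (nbhs_filter x)) => i.
  have [iS|iS] := boolP (i \in S); last first.
    by apply: nearW => y; rewrite /good /= (negPf iS).
  pose g (y : 'rV[R]_d) := (y *m Q) 0 i.
  have gu : g x - u i < g x by rewrite ltrBlDr ltrDl u0.
  near=> y => _.
  have : g x - u i < g y.
    near: y; exact: (cvgr_gt _ (@continuous_mulmx_coord _ _ _ Q i x) _ gu).
  by rewrite /g /c mulmxBl !mxE; lra.
near=> y => /affine_hull_simplex_sub yH.
have cy : forall i, i \in S -> 0 < u i + c y 0 i by near: y.
pose v : 'rV_n := \row_i u i + c y.
have vH : v *m simplex_rows S = row_mx (const_mx 1) y.
  rewrite mulmxDl.
  have uH : (\row_i u i) *m simplex_rows S = row_mx (const_mx 1) x.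
    rewrite mul_simplex_rows; under eq_bigr do rewrite mxE.
    by under [X in row_mx _ X]eq_bigr do rewrite mxE; rewrite u1.
  rewrite uH.
  have xH : (row_mx (const_mx 1) x <= simplex_rows S)%MS.
    by apply/submxP; eexists; rewrite -uH.
  have -> : c y =
      (row_mx (const_mx 1) y - row_mx (const_mx 1) x) *m
        pinvmx (simplex_rows S).
    rewrite opp_row_mx add_row_mx subrr -[pinvmx _]vsubmxK mul_row_col.
    by rewrite mul0mx add0r.
  by rewrite mulmxKpV ?subrKC// addmx_sub ?eqmx_opp.
have := vH; rewrite mul_simplex_rows => /eq_row_mx[/rowP/(_ 0) v1 <-].
rewrite !mxE in v1.
apply: simplex_convex_combination => // i iS.
have -> : v 0 i = u i + c y 0 i by rewrite mxE [X in X + _]mxE.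
by rewrite ltW ?cy.
Unshelve. all: by end_near.
Qed.

Lemma crossing_of_affine_dependency E (lam : 'rV[R]_n) : (0 < #|E|)%N ->
  affine_dependency p lam -> {in E, forall i, 0 < lam 0 i} ->
  {in ~: E, forall i, lam 0 i < 0} -> crosses p E (~: E).
Proof.
move=> /card_gt0P[i0 i0E] /affine_dependencyP[s0 sp0] pos neg.
split; first by rewrite disjoints_subset setCK.
pose s := \sum_(i in E) lam 0 i.
have s_gt0 : 0 < s.
  by rewrite /s (bigD1 i0)//= ltr_pwDl ?pos// sumr_ge0// => i /andP[/pos/ltW].
have e1 : s = - \sum_(i in ~: E) lam 0 i.
  apply/eqP; rewrite -subr_eq0 opprK -[X in _ == X]s0.
  rewrite [X in _ == X](bigID (mem E)) /=.
  by apply/eqP; congr +%R; apply: eq_bigl => i; rewrite inE.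
have e2 : \sum_(i in E) lam 0 i *: p i = - \sum_(i in ~: E) lam 0 i *: p i.
  apply/eqP; rewrite -subr_eq0 opprK -[X in _ == X]sp0.
  rewrite [X in _ == X](bigID (mem E)) /=.
  by apply/eqP; congr +%R; apply: eq_bigl => i; rewrite inE.
exists (s^-1 *: \sum_(i in E) lam 0 i *: p i); split.
  rewrite scaler_sumr; under eq_bigr do rewrite scalerA.
  apply: simplex_relative_interior => [i iE|].
    by rewrite mulr_gt0 ?invr_gt0// pos.
  by rewrite -mulr_sumr mulVf ?gt_eqF.
rewrite e2 -sumrN scaler_sumr.
under eq_bigr do rewrite -scaleNr scalerA.
apply: simplex_relative_interior => [i iE|].
  by rewrite mulr_gt0 ?invr_gt0// oppr_gt0 neg.
by rewrite -mulr_sumr sumrN -e1 mulVf ?gt_eqF.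
Qed.

End Crossing.

(** * Counting crossing pairs *)

Section Counting.
Context {R : realType} {d : nat} (p : 'I_(2 * d) -> 'rV[R]_d).
Hypothesis gp : general_position p.
Local Open Scope nat_scope.

(** Here [zP.1] is the zero added to [Z0] and [zP.2] the plus set of a balanced
    dependency, paired so that a single choice function selects both. *)
Lemma crossing_subcube (Z0 : {set 'I_(2 * d)}) : 3 <= d -> #|Z0| = d - 3 ->
  exists zP : 'I_(2 * d) * {set 'I_(2 * d)}, let Z := zP.1 |: Z0 in
  [/\ #|Z| = d - 2, [disjoint zP.2 & Z]%B, d.+1 <= #|zP.2|.*2 <= d.+3 &
    forall E : {set 'I_(2 * d)}, E \in subcube_layer Z zP.2 d ->
      crosses p E (~: E)].
Proof.
move=> d3 cZ0.
have cY : #|~: Z0| = d.+3 by rewrite cardsCs setCK card_ord; lia.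
have [z zY [lam [dl lamE lamP]]] := balanced_cocircuit gp cY.
have zZ0 : z \notin Z0 by rewrite inE in zY.
exists (z, [set i | (0 < lam ord0 i)%R]%SET) => /=.
have ZC : z |: Z0 = ~: (~: Z0 :\ z).
  by apply/setP => i; rewrite !inE negb_and !negbK.
split=> //.
- by rewrite cardsU1 zZ0 cZ0; lia.
- rewrite disjoints_subset ZC setCK; apply/subsetP => i.
  by rewrite inE -lamE => /gt_eqF ->.
move=> E; rewrite inE => /andP[/eqP EP /eqP cE].
have cW : #|~: Z0 :\ z| = d.+2.
  by have := cardsD1 z (~: Z0); rewrite zY cY; lia.
have EW : E :&: (~: Z0 :\ z) = [set i | (0 < lam ord0 i)%R]%SET.
  by rewrite -EP ZC [RHS]setDE setCK.
have [nu [dnu pos neg]] := cocircuit_signs gp cW dl lamE EW.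
by apply: (crossing_of_affine_dependency _ dnu) => //; rewrite cE; lia.
Qed.

(** Adding a vertex to each of [Z0 i] and [Z0 j] enlarges their intersection
    by at most two vertices. *)
Lemma crossing_family N (Z0 : nat -> {set 'I_(2 * d)}) : 3 <= d ->
  (forall i, i < N -> #|Z0 i| = d - 3) ->
  (forall i j, i < j < N -> #|Z0 i :&: Z0 j| <= d - 3 - N) -> N + 3 <= d ->
  exists F : nat -> {set {set 'I_(2 * d)}},
  [/\ forall i, i < N -> 4 ^ (d - 2) <= #|F i| ^ 2 * (2 * d),
      forall i j, i < j < N -> #|F i :&: F j| <= 2 ^ (d - 1 - N) &
      forall i E, i < N -> E \in F i ->
        #|E| = d /\ crosses p E (~: E)].
Proof.
move=> d3 cZ0 cZI Nd.
have /choice[zP zPE] : forall i, exists zP : 'I_(2 * d) * {set 'I_(2 * d)},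
  i < N -> let Z := zP.1 |: Z0 i in
  [/\ #|Z| = d - 2, [disjoint zP.2 & Z]%B, d.+1 <= #|zP.2|.*2 <= d.+3 &
    forall E : {set 'I_(2 * d)}, E \in subcube_layer Z zP.2 d ->
      crosses p E (~: E)].
  move=> i; have [iN|iN] := boolP (i < N).
    have [zP h] := crossing_subcube d3 (cZ0 i iN).
    by exists zP.
  have d0 : 0 < 2 * d by lia.
  by exists (Ordinal d0, set0).
exists (fun i => subcube_layer ((zP i).1 |: Z0 i) (zP i).2 d); split.
- move=> i iN; have [cZ dZ /andP[P1 P2] _] := zPE i iN.
  have Pd : #|(zP i).2| <= d by lia.
  have := card_subcube_layer dZ Pd; rewrite cZ => le.
  have h : 4 ^ (d - 2) <= 'C(d - 2, d - #|(zP i).2|) ^ 2 * (2 * (d - 2).+1).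
    by apply: near_central_bin_lower; lia.
  by apply: leq_trans h _; rewrite leq_mul ?leq_exp2r//; lia.
- move=> i j /andP[ij jN]; apply: leq_trans (card_subcube_layerI _ _ _ _ _) _.
  rewrite leq_exp2l//.
  have sub : ((zP i).1 |: Z0 i) :&: ((zP j).1 |: Z0 j) \subset
      (zP i).1 |: ((zP j).1 |: (Z0 i :&: Z0 j)).
    apply/subsetP => v; rewrite !inE => /andP[/orP[->//|->] /orP[->|->]];
    by rewrite ?orbT.
  apply: leq_trans (subset_leq_card sub) _.
  rewrite !cardsU1; have := cZI i j; rewrite ij jN => /(_ isT).
  move: #|Z0 i :&: Z0 j| => c.
  by case: (_ \notin _); case: (_ \notin _) => /=; lia.
- move=> i E iN EF; have [_ _ _ h] := zPE i iN; split; last exact: h.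
  by move: EF; rewrite inE => /andP[_ /eqP].
Qed.

(** A crossing pair has at most two members, and every set of [U] is a member
    of one. *)
Lemma card_crossing_sets_le (U : {set {set 'I_(2 * d)}}) :
  (forall E, E \in U -> #|E| = d /\ crosses p E (~: E)) ->
  #|U| <= 2 * #|crossing_pairs p|.
Proof.
move=> UE.
have sub : U \subset cover (crossing_pairs p).
  apply/subsetP => E EU; have [cE cr] := UE E EU.
  apply/bigcupP; exists [set E; ~: E]%SET; last by rewrite !inE eqxx.
  rewrite inE; apply/asboolP; exists E, (~: E); split=> //.
    by rewrite inE cE.
  by rewrite inE cardsCs setCK card_ord cE; apply/eqP; lia.
apply: leq_trans (subset_leq_card sub) _.
apply: leq_trans (leq_card_cover _) _.
rewrite [X in _ <= X]mulnC -sum_nat_const; apply: leq_sum => Q.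
rewrite inE => /asboolP[E [F [_ _ -> _]]].
by rewrite cards2; case: (_ != _).
Qed.

(** Each of the [N] families has at least [2 ^ (d - 2) / (3 * N)] sets, and the
    overlaps cost at most half of the total: the union has at least
    [2 ^ (d - 2) / 6] sets, which come from half as many pairs or more.  The
    bound on [d] is ample for [12 * N ^ 2 <= 2 ^ N], which controls the
    overlaps. *)
Lemma card_crossing_pairs_lower : 256 <= d ->
  2 ^ d <= 48 * #|crossing_pairs p|.
Proof.
move=> d256.
have [N /andP[N1 N2]] := exists_nat_sqrt d.
rewrite -!mulnn in N1 N2.
have N16 : 16 <= N by nia.
have Nd : N + 3 <= d by nia.
(* [N ^ 2 <= d] lets the [N] blocks [B i] of size [N] fit into [X]. *)
pose X := [set v : 'I_(2 * d) | 0 <= v < d - 3 + N]%SET.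
pose B i := [set v : 'I_(2 * d) | i * N <= v < i * N + N]%SET.
have iNN i : i < N -> i * N + N <= d by nia.
have cX : #|X| = d - 3 + N by rewrite card_ord_interval; lia.
have cB i : i < N -> #|B i| = N.
  by move=> /iNN h; rewrite card_ord_interval; lia.
have BX i : i < N -> B i \subset X.
  by move=> /iNN h; apply/subsetP => v; rewrite !inE; lia.
have [||||F [F1 F2 F3]] := @crossing_family N (fun i => X :\: B i).
- lia.
- by move=> i iN; rewrite cardsD (setIidPr (BX i iN)) cX cB//; lia.
- move=> i j /andP[ij jN]; have iN := ltn_trans ij jN.
  have -> : (X :\: B i) :&: (X :\: B j) = X :\: (B i :|: B j).
    by apply/setP => v; rewrite !inE; lia.
  rewrite cardsD (setIidPr _) ?subUset ?BX// cX cardsU !cB//.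
  have -> : B i :&: B j = set0.
    by apply/setP => v; rewrite !inE; nia.
  by rewrite cards0; lia.
- exact: Nd.
have := bonferroni F2; set U := (X in #|X| + _) => hU.
have cU : #|U| <= 2 * #|crossing_pairs p|.
  apply: card_crossing_sets_le => E /bigcupP[i _ EF].
  exact: (F3 i).
(* [d < N.+1 ^ 2] gives [2 * d <= (3 * N) ^ 2]. *)
have Fi i : i < N -> 2 ^ (d - 2) <= 3 * N * #|F i|.
  move=> iN; rewrite -(@leq_exp2r _ _ 2)// -expnM mulnC expnM.
  apply: leq_trans (F1 i iN) _; rewrite -!mulnn.
  move: #|F i| => c.
  apply: (@leq_trans (c * c * (9 * (N * N)))); last by lia.
  by rewrite leq_mul2l; apply/orP; right; nia.
have hsum : N * 2 ^ (d - 2) <= 3 * N * \sum_(i < N) #|F i|.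
  rewrite big_distrr /= -[X in X * _]card_ord -sum_nat_const.
  by apply: leq_sum => i _; exact: Fi.
have e1 : 2 ^ (d - 2) * 2 = 2 ^ N * 2 ^ (d - 1 - N).
  by rewrite -expnSr -expnD; congr (2 ^ _); lia.
have e2 : 2 ^ d = 4 * 2 ^ (d - 2).
  by rewrite -(@expnD 2 2); congr (2 ^ _); lia.
have h12 := @exp2_ge_12sqr N; rewrite -mulnn in h12.
have {}h12 : 12 * (N * N) * 2 ^ (d - 1 - N) <= 2 ^ (d - 2) * 2.
  by rewrite e1 leq_mul2r h12 ?orbT//; lia.
rewrite e2; move: h12 hsum hU cU.
move: (2 ^ (d - 1 - N)) (2 ^ (d - 2)) (\sum_(i < N) #|F i|) #|U|.
move: #|crossing_pairs p| => k Q D s u h12 hsum hU cU.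
have : D <= 3 * s.
  have N0 : 0 < N by lia.
  by rewrite -(leq_pmul2l N0); lia.
lia.
Qed.

End Counting.

Theorem theorem1 (R : realType) :
  exists2 C : R, 0 < C &
    exists d0 : nat, forall d : nat, (2 <= d)%N -> (d0 <= d)%N ->
      C * 2 ^+ d <= (rectilinear_crossing_number R d (2 * d))%:R.
Proof.
exists 48%:R^-1; first by rewrite invr_gt0 ltr0n.
exists 256%N => d _ d256; rewrite /rectilinear_crossing_number.
case: ex_minnP => k /asboolP[p [gp <-]] _.
rewrite ler_pdivrMl ?ltr0n// -natrX -natrM ler_nat.
exact: card_crossing_pairs_lower.
Qed.
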